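(* Let $\Phi$ be a Drinfeld $A$-module of rank $2$ over $L$, with characteristic polynomial of Frobenius $P_\Phi(X)=X^2-cX+\mu P^m$. Then $L^{\Phi}\simeq\frac{A}{I_1}\oplus\frac{A}{I_2}$ for some ideals $I_1=(i_1)$, $I_2=(i_2)$ of $A$ with $i_2\mid i_1$; and if $\Phi$ is ordinary, then $i_2\mid (c-2)$.
   Context: Let $q$ be a prime power, $A=\mathbf{F}_q[T]$, $K=\mathbf{F}_q(T)$. Let $L$ be a finite field which is an extension of degree $n$ of $\mathbf{F}_q$, equipped with an $\mathbf{F}_q$-algebra homomorphism $\gamma:A\to L$; its kernel is a nonzero prime ideal, the $A$-characteristic of $L$, and $P$ denotes both this ideal and its monic generator. Put $d=\deg P$ and $m=[L:A/P]$, so $n=md$. Let $L\{\tau\}$ be the ring of polynomials in $\tau$ with multiplication determined by $\tau\lambda=\lambda^q\tau$ for $\lambda\in L$. It acts on any extension of $L$, with $\tau$ acting as $x\mapsto x^q$. A Drinfeld $A$-module of rank $2$ over $L$ is an $\mathbf{F}_q$-algebra homomorphism $\Phi:A\to L\{\tau\}$, $a\mapsto\Phi_a$, such that the constant coefficient of $\Phi_a$ is $\gamma(a)$ for all $a$, and $\Phi_T=\gamma(T)+a_1\tau+a_2\tau^2$ with $a_1,a_2\in L$, $a_2\neq0$. $L^{\Phi}$ denotes the additive group of $L$ with the $A$-module structure $a\cdot x=\Phi_a(x)$. $\Phi$ is supersingular if the module of $P$-division points $\{x\in\overline{L}:\Phi_P(x)=0\}$ is trivial, and ordinary otherwise. The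 Frobenius of $L$ is $F=\tau^n$. Its characteristic polynomial $P_\Phi$ (that of $F$ acting on the Tate modules of $\Phi$ at primes different from $P$) has the form $P_\Phi(X)=X^2-cX+\mu P^m$ with $c\in A$, $\mu\in\mathbf{F}_q^{*}$. *)

(* Defs.v *)
From HB Require Import structures.
From mathcomp Require Import all_boot all_algebra falgebra fieldext finfield generic_quotient ring_quotient.
From mathcomp Require Import boolp functions.

Set Implicit Arguments.
Unset Strict Implicit.
Unset Printing Implicit Defensive.

Import GRing.Theory.
Local Open Scope ring_scope.
Local Open Scope quotient_scope.

Section QPower.
Variables (F : finFieldType) (E : fieldType) (j : {rmorphism F -> E}).
Implicit Types x y : E.

Lemma qpow_nat i : [pchar E].-nat (#|F| ^ i)%N.
Proof.
have [p p_pr pF] := finPcharP F.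
have pE : p \in [pchar E] by rewrite (fmorph_pchar j).
by rewrite (card_pprimeChar pF) !pnatX pnatE // pE.
Qed.

Lemma qpowD i x y : (x + y) ^+ (#|F| ^ i) = x ^+ (#|F| ^ i) + y ^+ (#|F| ^ i).
Proof. exact: exprDn_pchar (qpow_nat i). Qed.

Lemma q_gt0 i : (0 < #|F| ^ i)%N.
Proof. by rewrite expn_gt0; apply/orP; left; apply/card_gt0P; exists 0. Qed.

Lemma qpow0 i : (0 : E) ^+ (#|F| ^ i) = 0.
Proof. by rewrite expr0n eqn0Ngt q_gt0. Qed.

Lemma qpow_sum i I (r : seq I) (P : pred I) (f : I -> E) :
  (\sum_(k <- r | P k) f k) ^+ (#|F| ^ i) = \sum_(k <- r | P k) f k ^+ (#|F| ^ i).
Proof.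
exact: (big_morph (fun x => x ^+ (#|F| ^ i)) (qpowD i) (qpow0 i)).
Qed.

Lemma qpow_scalar i (a : F) : (j a) ^+ (#|F| ^ i) = j a.
Proof.
rewrite -rmorphXn; congr (j _).
by elim: i => [|i IH]; rewrite ?expr1 // expnS exprM expf_card.
Qed.
End QPower.

(* L{tau}: the polynomial with coefficients l_0, l_1, ... stands for
   l_0 + l_1 tau + ... ; only the additive structure is that of {poly L}. *)
Definition skew_poly (F : finFieldType) (L : fieldExtType F) : Type := {poly L}.

Section SkewPoly.
Variables (F : finFieldType) (L : fieldExtType F).
Local Notation q := #|F|.
Local Notation S := (skew_poly L).
Local Notation jL := (GRing.in_alg L : {rmorphism F -> L}).

HB.instance Definition _ := GRing.Zmodule.on S.

Definition scoef (f : S) (i : nat) : L := (f : {poly L})`_i.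
Definition ssize (f : S) : nat := size (f : {poly L}).

Definition skewC (c : L) : S := (c%:P : {poly L}).
Definition tau : S := ('X : {poly L}).

(* (l tau^i) (l' tau^j) = l l'^(q^i) tau^(i + j) *)
Definition skew_mul (f g : S) : S :=
  \poly_(k < (ssize f + ssize g).-1)
    (\sum_(i < k.+1) scoef f i * scoef g (k - i) ^+ (q ^ i)).

Lemma scoef_inj (f g : S) : (forall i, scoef f i = scoef g i) -> f = g.
Proof. by move=> e; apply/polyP. Qed.

Lemma scoefD f g i : scoef (f + g) i = scoef f i + scoef g i.
Proof. exact: coefD. Qed.

Lemma scoef_mul f g k :
  scoef (skew_mul f g) k = \sum_(i < k.+1) scoef f i * scoef g (k - i) ^+ (q ^ i).
Proof.
rewrite /scoef coef_poly ltn_predRL; case: leqP => // le_pq.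
rewrite big1 // => i _; rewrite /ssize in le_pq.
have [lq|lt] := leqP (size (f : {poly L})) i.
  by rewrite (nth_default _ lq) mul0r.
rewrite [X in X ^+ _]nth_default ?qpow0 ?mulr0 // leq_subRL -ltnS //.
by rewrite (leq_trans _ le_pq) // ltn_add2r.
Qed.

Lemma scoef_mul_rev f g k : scoef (skew_mul f g) k =
  \sum_(i < k.+1) scoef f (k - i) * scoef g i ^+ (q ^ (k - i)).
Proof.
rewrite scoef_mul (reindex_inj rev_ord_inj) /=.
by apply: eq_bigr => i _; rewrite (sub_ordK i).
Qed.

Lemma scoefC c i : scoef (skewC c) i = if i == 0%N then c else 0.
Proof. exact: coefC. Qed.

Lemma skew_mulA : associative skew_mul.
Proof.
move=> f g h; apply: scoef_inj => i; rewrite scoef_mul scoef_mul_rev.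
pose c3 j k := scoef f j * scoef g (i - j - k) ^+ (q ^ j)
                 * scoef h k ^+ (q ^ (i - k)).
transitivity (\sum_(j < i.+1) \sum_(k < i.+1 | (k <= i - j)%N) c3 j k).
  apply: eq_bigr => /= j _.
  rewrite scoef_mul_rev (qpow_sum jL) big_distrr /=.
  rewrite (big_ord_narrow_leq (leq_subr _ _)) /=.
  apply: eq_bigr => k _; rewrite /c3 exprMn mulrA -exprM -expnD; congr (_ * _ ^+ (q ^ _)).
  have le_kj := ltn_ord k; have le_j := ltn_ord j; rewrite /= !ltnS in le_kj le_j.
  by rewrite subnAC subnK // leq_subRL ?(leq_trans le_kj) ?leq_subr // addnC -leq_subRL.
rewrite (exchange_big_dep predT) //=; apply: eq_bigr => k _.
transitivity (\sum_(j < i.+1 | (j <= i - k)%N) c3 j k).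
  apply: eq_bigl => j; rewrite -ltnS -(ltnS j) -!subSn ?leq_ord //.
  by rewrite -subn_gt0 -(subn_gt0 j) -!subnDA addnC.
rewrite (big_ord_narrow_leq (leq_subr _ _)) scoef_mul big_distrl /=.
by apply: eq_bigr => j _; rewrite /c3 -!subnDA addnC.
Qed.

Lemma scoef_mulCl c f i : scoef (skew_mul (skewC c) f) i = c * scoef f i.
Proof.
rewrite scoef_mul big_ord_recl subn0 scoefC eqxx expr1 big1 ?addr0 //.
by move=> j _; rewrite scoefC mul0r.
Qed.

Lemma scoef_mulCr c f i : scoef (skew_mul f (skewC c)) i = scoef f i * c ^+ (q ^ i).
Proof.
rewrite scoef_mul_rev big_ord_recl subn0 scoefC eqxx big1 ?addr0 //.
by move=> j _; rewrite scoefC qpow0 mulr0.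
Qed.

Lemma skew_mul1l : left_id (skewC 1) skew_mul.
Proof. by move=> f; apply: scoef_inj => i; rewrite scoef_mulCl mul1r. Qed.

Lemma skew_mul1r : right_id (skewC 1) skew_mul.
Proof. by move=> f; apply: scoef_inj => i; rewrite scoef_mulCr expr1n mulr1. Qed.

Lemma skew_mulDl : left_distributive skew_mul +%R.
Proof.
move=> f g h; apply: scoef_inj => i; rewrite scoefD !scoef_mul -big_split.
by apply: eq_bigr => k _; rewrite scoefD mulrDl.
Qed.

Lemma skew_mulDr : right_distributive skew_mul +%R.
Proof.
move=> f g h; apply: scoef_inj => i; rewrite scoefD !scoef_mul -big_split.
by apply: eq_bigr => k _; rewrite scoefD (qpowD jL) mulrDr.
Qed.

Lemma skew_1neq0 : skewC 1 != 0.
Proof. exact: (oner_neq0 {poly L}). Qed.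

HB.instance Definition _ := GRing.Zmodule_isNzRing.Build S
  skew_mulA skew_mul1l skew_mul1r skew_mulDl skew_mulDr skew_1neq0.

Definition skew_scale (a : F) (f : S) : S := skewC (a%:A) * f.

Lemma skewCD c c' : skewC (c + c') = skewC c + skewC c'.
Proof. exact: polyCD. Qed.

Lemma skewCM c c' : skewC (c * c') = skewC c * skewC c'.
Proof.
by apply: scoef_inj => i; rewrite scoef_mulCl !scoefC; case: eqP; rewrite ?mulr0.
Qed.

Lemma skew_scaleA a b f : skew_scale a (skew_scale b f) = skew_scale (a * b) f.
Proof. by rewrite /skew_scale mulrA -skewCM -in_algE -rmorphM. Qed.
Lemma skew_scale1 : left_id 1 skew_scale.
Proof. by move=> f; rewrite /skew_scale scale1r mul1r. Qed.
Lemma skew_scaleDr : right_distributive skew_scale +%R.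
Proof. by move=> a f g; rewrite /skew_scale mulrDr. Qed.
Lemma skew_scaleDl f : {morph skew_scale^~ f : a b / a + b}.
Proof. by move=> a b; rewrite /skew_scale scalerDl skewCD mulrDl. Qed.

HB.instance Definition _ := GRing.Zmodule_isLmodule.Build F S
  skew_scaleA skew_scale1 skew_scaleDr skew_scaleDl.

Lemma skew_scaleAl (a : F) (f g : S) : a *: (f * g) = (a *: f) * g.
Proof. exact: mulrA. Qed.

HB.instance Definition _ := GRing.Lmodule_isLalgebra.Build F S skew_scaleAl.

Lemma skew_scaleAr (a : F) (f g : S) : a *: (f * g) = f * (a *: g).
Proof.
suff sc h : skewC (a%:A) * h = h * skewC (a%:A).
  by rewrite -!/(skew_scale _ _) /GRing.scale /= /skew_scale mulrA sc mulrA.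
apply: scoef_inj => i; rewrite scoef_mulCl scoef_mulCr mulrC.
by congr (_ * _); rewrite -in_algE (qpow_scalar jL).
Qed.

HB.instance Definition _ := GRing.Lalgebra_isAlgebra.Build F S skew_scaleAr.

Lemma tauC (c : L) : tau * skewC c = skewC (c ^+ q) * tau.
Proof.
apply: scoef_inj => i; rewrite scoef_mulCl scoef_mulCr /scoef coefX.
by case: eqP => [->|_]; rewrite ?expn1 ?mul0r ?mulr0 // mulr1 mul1r.
Qed.

Lemma scoef_tauX n i : scoef (tau ^+ n) i = (i == n)%:R.
Proof.
elim: n i => [|n IH] i; first by rewrite expr0 scoefC; case: eqP.
rewrite exprS scoef_mul; case: i => [|i].
  by rewrite big_ord1 /scoef coefX mul0r.
rewrite 2!big_ord_recl big1 ?addr0.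
  rewrite /scoef !coefX mul0r add0r mul1r -/(scoef _ _) IH subSS subn0 expn1.
  by rewrite eqSS; case: eqP; rewrite ?expr1n // -{1}[q]expn1 qpow0.
by move=> k _; rewrite /scoef coefX mul0r.
Qed.

Section Action.
Variables (E : fieldType) (iota : {rmorphism L -> E}).
Local Notation jE := (iota \o jL : {rmorphism F -> E}).

(* the action of L{tau} on an extension E of L: tau acts as x |-> x ^+ q *)
Definition skew_act (f : S) (x : E) : E :=
  \sum_(i < ssize f) iota (scoef f i) * x ^+ (q ^ i).

Lemma skew_actE N f x : (ssize f <= N)%N ->
  skew_act f x = \sum_(0 <= i < N) iota (scoef f i) * x ^+ (q ^ i).
Proof.
move=> le_N.
rewrite /skew_act -(big_mkord xpredT (fun i => iota (scoef f i) * x ^+ (q ^ i))).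
rewrite (big_cat_nat (n := ssize f) (p := N)) //=.
rewrite [X in _ + X]big_nat_cond [X in _ + X]big1 ?addr0 // => i.
rewrite andbT => /andP[le_i _].
by rewrite /scoef nth_default // rmorph0 mul0r.
Qed.

Lemma skew_actDl f g x : skew_act (f + g) x = skew_act f x + skew_act g x.
Proof.
pose N := maxn (ssize (f + g)) (maxn (ssize f) (ssize g)).
rewrite !(@skew_actE N) ?leq_max ?leqnn ?orbT // -big_split /=.
by apply: eq_bigr => i _; rewrite scoefD rmorphD mulrDl.
Qed.

Lemma skew_actDr f x y : skew_act f (x + y) = skew_act f x + skew_act f y.
Proof.
by rewrite -big_split; apply: eq_bigr => i _; rewrite (qpowD jE) mulrDr.
Qed.

Lemma skew_act0r f : skew_act f 0 = 0.
Proof. by rewrite /skew_act big1 // => i _; rewrite qpow0 mulr0. Qed.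

Lemma skew_actC c x : skew_act (skewC c) x = iota c * x.
Proof.
rewrite (@skew_actE 1) ?big_nat1 ?scoefC ?expr1 //.
exact: size_polyC_leq1.
Qed.

Lemma skew_act1 x : skew_act 1 x = x.
Proof. by rewrite skew_actC rmorph1 mul1r. Qed.

Lemma skew_act_tauX n x : skew_act (tau ^+ n) x = x ^+ (q ^ n).
Proof.
rewrite (@skew_actE (maxn (ssize (tau ^+ n)) n.+1)) ?leq_maxl //.
rewrite big_mkord.
have lt_n : (n < maxn (ssize (tau ^+ n)) n.+1)%N by rewrite leq_maxr.
rewrite (bigD1 (Ordinal lt_n)) //= scoef_tauX eqxx rmorph1 mul1r big1 ?addr0 //.
move=> i; rewrite -val_eqE /= => /negbTE ne.
by rewrite scoef_tauX ne rmorph0 mul0r.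
Qed.

Lemma skew_actM f g x : skew_act (f * g) x = skew_act f (skew_act g x).
Proof.
pose h i j := iota (scoef f i) * (iota (scoef g j) ^+ (q ^ i) * x ^+ (q ^ (i + j))).
have hl i j : (ssize f <= i)%N -> h i j = 0.
  by move=> le_i; rewrite /h /scoef nth_default // rmorph0 mul0r.
have hr i j : (ssize g <= j)%N -> h i j = 0.
  move=> le_j; rewrite /h [scoef g j]nth_default // rmorph0 qpow0 mul0r mulr0 //.
pose M := ssize f; pose K := ssize g.
have leN : (ssize (f * g)%R <= M + K)%N.
  by apply: leq_trans (size_poly _ _) _; exact: leq_pred.
rewrite (skew_actE _ leN).
transitivity (\sum_(0 <= k < M + K) \sum_(0 <= i < M + K | (i <= k)%N) h i (k - i)%N).
  apply: eq_big_nat => k /andP[_ lt_k]; rewrite scoef_mul rmorph_sum mulr_suml /=.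
  rewrite (big_ord_widen (M + K) (fun i =>
    iota (scoef f i * scoef g (k - i) ^+ (q ^ i)) * x ^+ (q ^ k))) // big_mkord.
  apply: eq_bigr => i le_i.
  by rewrite /h rmorphM rmorphXn -mulrA subnKC.
rewrite (exchange_big_dep_nat xpredT) //= (skew_actE _ (leqnn (ssize f))).
rewrite [LHS](big_cat_nat (n := M) (p := M + K)) ?leq_addr //=.
rewrite [X in _ + X]big_nat [X in _ + X]big1 ?addr0; last first.
  by move=> i /andP[le_i _]; rewrite big1 // => k _; rewrite hl.
apply: eq_big_nat => i /andP[_ lt_i].
rewrite (qpow_sum jE) mulr_sumr.
transitivity (\sum_(0 <= j < K) h i j); last first.
  rewrite big_mkord; apply: eq_bigr => k _.
  by rewrite exprMn -exprM -expnD addnC.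
have le_i : (i <= M + K)%N by rewrite (leq_trans (ltnW lt_i)) ?leq_addr.
rewrite (big_cat_nat (n := i) (p := M + K)) //=.
rewrite big_nat_cond big1 ?add0r; last first.
  by move=> k /andP[/andP[_ lt_k]]; rewrite leqNgt lt_k.
rewrite -{1}[i]add0n big_addn.
rewrite (eq_big (fun=> true) (fun k => h i k)) => [|k|k _]; last first.
- by rewrite addnK.
- by rewrite leq_addl.
rewrite (big_cat_nat (n := K)) //=; last by rewrite -(leq_add2r i) subnK // addnC leq_add2r ltnW.
rewrite [X in _ + X]big_nat [X in _ + X]big1 ?addr0 //.
by move=> k /andP[le_k _]; rewrite hr.
Qed.
End Action.
End SkewPoly.

Section QuotientModule.
Variable F : finFieldType.
Local Notation A := {poly F}.

Definition principal_ideal (i : A) : {pred A} := fun a => i %| a.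

Lemma principal_ideal_zmod_closed i : zmod_closed (principal_ideal i).
Proof.
by split=> [|a b]; rewrite !unfold_in ?dvdp0 // => ia ib; rewrite dvdp_subr.
Qed.

HB.instance Definition _ i :=
  GRing.isZmodClosed.Build A (principal_ideal i) (principal_ideal_zmod_closed i).

(* A/(i) as an A-module; the library's ring quotients exclude i = 1, which
   occurs here. *)
Definition quotA (i : A) : Type := Quotient.quot (principal_ideal i).

HB.instance Definition _ i := GRing.Zmodule.on (quotA i).

Section OneIdeal.
Variable i : A.
Local Notation Q := (Quotient.quot (principal_ideal i)).

Definition quot_pi (a : A) : quotA i := \pi_Q a.

Lemma quot_piE a b : quot_pi a = quot_pi b <-> i %| a - b.
Proof.
split=> [e|d].
  have : \pi_Q a == \pi_Q b by apply/eqP.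
  by rewrite -Quotient.idealrBE.
by apply/eqP; rewrite -[_ == _]Quotient.idealrBE.
Qed.

Lemma quot_piD a b : quot_pi (a + b) = quot_pi a + quot_pi b.
Proof. exact: (raddfD (\pi_Q)). Qed.

Definition quot_scale (a : A) (x : quotA i) : quotA i := quot_pi (a * repr (x : Q)).

Lemma quot_reprK (x : quotA i) : quot_pi (repr (x : Q)) = x.
Proof. exact: (@reprK _ Q). Qed.

Lemma quot_scale_pi a b : quot_scale a (quot_pi b) = quot_pi (a * b).
Proof.
apply/quot_piE; rewrite -mulrBr dvdp_mull //.
by apply/quot_piE; rewrite quot_reprK.
Qed.

Lemma quot_scaleA a b x : quot_scale a (quot_scale b x) = quot_scale (a * b) x.
Proof. by rewrite -[x]quot_reprK !quot_scale_pi mulrA. Qed.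
Lemma quot_scale1 : left_id 1 quot_scale.
Proof. by move=> x; rewrite -[x]quot_reprK !quot_scale_pi mul1r. Qed.
Lemma quot_scaleDr : right_distributive quot_scale +%R.
Proof.
move=> a x y; rewrite -[x]quot_reprK -[y]quot_reprK -quot_piD !quot_scale_pi.
by rewrite mulrDr quot_piD.
Qed.
Lemma quot_scaleDl x : {morph quot_scale^~ x : a b / a + b}.
Proof. by move=> a b; rewrite -[x]quot_reprK !quot_scale_pi mulrDl quot_piD. Qed.

HB.instance Definition _ := GRing.Zmodule_isLmodule.Build A (quotA i)
  quot_scaleA quot_scale1 quot_scaleDr quot_scaleDl.
End OneIdeal.
End QuotientModule.

Record prime_poly (F : finFieldType) := PrimePoly {
  prime_val :> {poly F};
  prime_monic : prime_val \is monic;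
  prime_irr : irreducible_poly prime_val }.

Section Adic.
Variables (F : finFieldType) (l : prime_poly F).
Local Notation A := {poly F}.

(* The completion A_l, as the inverse limit of the A/(l^k): u k is the residue
   modulo l^k, taken of degree < deg l^k. *)
Definition adic_pred : {pred nat -> A} :=
  fun u => `[< forall k, u k.+1 %% prime_val l ^+ k = u k >].

Lemma adic_zmod_closed : zmod_closed adic_pred.
Proof.
split=> [|u v /asboolP hu /asboolP hv]; apply/asboolP => k; first exact: mod0p.
by rewrite !fctE modpD modpN hu hv.
Qed.

HB.instance Definition _ :=
  GRing.isZmodClosed.Build (nat -> A) adic_pred adic_zmod_closed.

Record adic := Adic { adic_seq :> nat -> A; adic_seqP : adic_seq \in adic_pred }.

HB.instance Definition _ := [isSub for adic_seq].
HB.instance Definition _ := [Choice of adic by <:].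
HB.instance Definition _ := [SubChoice_isSubZmodule of adic by <:].

Lemma adic_inj (u v : adic) : (forall k, u k = v k) -> u = v.
Proof. by move=> e; apply: val_inj; apply/funext. Qed.

Lemma adic_step (u : adic) k : u k.+1 %% prime_val l ^+ k = u k.
Proof. by case: u => u /= /asboolP. Qed.

Lemma adic_mod (u : adic) k : u k %% prime_val l ^+ k = u k.
Proof. by rewrite -[in LHS]adic_step modp_id adic_step. Qed.

Lemma modp_modX (a : A) k :
  (a %% prime_val l ^+ k.+1) %% prime_val l ^+ k = a %% prime_val l ^+ k.
Proof.
rewrite {2}(divp_eq a (prime_val l ^+ k.+1)) modpD exprS mulrA modp_mull add0r.
by [].
Qed.

Lemma adic_ofP (a : A) : (fun k => a %% prime_val l ^+ k) \in adic_pred.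
Proof. by apply/asboolP => k; exact: modp_modX. Qed.
Definition adic_of (a : A) : adic := Adic (adic_ofP a).

Lemma adic_mulP (u v : adic) :
  (fun k => (u k * v k) %% prime_val l ^+ k) \in adic_pred.
Proof.
apply/asboolP => k; rewrite modp_modX -modp_mul adic_step mulrC -modp_mul.
by rewrite adic_step mulrC.
Qed.
Definition adic_mul (u v : adic) : adic := Adic (adic_mulP u v).

Lemma modp_mull2 (a b m : A) : ((a %% m) * b) %% m = (a * b) %% m.
Proof. by rewrite mulrC modp_mul mulrC. Qed.

Lemma adic_mulA : associative adic_mul.
Proof.
by move=> u v w; apply: adic_inj => k /=; rewrite modp_mul modp_mull2 mulrA.
Qed.

Lemma adic_mulC : commutative adic_mul.
Proof. by move=> u v; apply: adic_inj => k /=; rewrite mulrC. Qed.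

Lemma adic_mul1 : left_id (adic_of 1) adic_mul.
Proof. by move=> u; apply: adic_inj => k /=; rewrite modp_mull2 mul1r adic_mod. Qed.

Lemma adic_mulDl : left_distributive adic_mul +%R.
Proof.
by move=> u v w; apply: adic_inj => k /=; rewrite [LHS]/= mulrDl modpD.
Qed.

Lemma adic_1neq0 : adic_of 1 != 0.
Proof.
apply/eqP => /(congr1 (fun u : adic => u 1%N)) /=; rewrite expr1 => /modp_eq0P.
by rewrite dvdp1; case: (prime_irr l) => h _ /eqP e; rewrite e in h.
Qed.

HB.instance Definition _ := GRing.Zmodule_isComNzRing.Build adic
  adic_mulA adic_mulC adic_mul1 adic_mulDl adic_1neq0.

Lemma adic_of_zmod : zmod_morphism adic_of.
Proof. by move=> a b; apply: adic_inj => k /=; rewrite modpD modpN. Qed.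
Lemma adic_of_monoid : monoid_morphism adic_of.
Proof.
by split=> // a b; apply: adic_inj => k /=; rewrite modp_mul modp_mull2.
Qed.

HB.instance Definition _ := GRing.isZmodMorphism.Build A adic adic_of adic_of_zmod.
HB.instance Definition _ := GRing.isMonoidMorphism.Build A adic adic_of adic_of_monoid.
End Adic.

Section Drinfeld.
Variables (F : finFieldType) (L : fieldExtType F).
Variable gamma : {lrmorphism {poly F} -> L}.
Local Notation A := {poly F}.
Local Notation q := #|F|.
Local Notation jL := (GRing.in_alg L : {rmorphism F -> L}).

(* P is the monic generator of the kernel of gamma *)
Definition is_characteristic (P : A) : Prop :=
  P \is monic /\ forall a : A, gamma a = 0 <-> P %| a.

(* m = [L : A/P], where A/P is identified with its image F(gamma T) in L *)
Definition char_index : nat := \dim_(<<1; gamma 'X>>%VS) {:L}.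

Record drinfeld2 := Drinfeld2 {
  dmap :> {lrmorphism A -> skew_poly L};
  dmap_const : forall a, scoef (dmap a) 0 = gamma a;
  dmap_rank2 : exists a1 a2 : L, a2 != 0 /\
    dmap 'X = skewC (gamma 'X) + skewC a1 * tau L + skewC a2 * tau L ^+ 2 }.

(* the additive group of an extension E of L, with a *: x = Phi_a(x) *)
Definition pts (Phi : drinfeld2) (E : fieldType) (iota : {rmorphism L -> E}) : Type := E.

Section Points.
Variables (Phi : drinfeld2) (E : fieldType) (iota : {rmorphism L -> E}).
Local Notation M := (pts Phi iota).

HB.instance Definition _ := GRing.Zmodule.on M.

Definition pts_scale (a : A) (x : M) : M := skew_act iota (Phi a) x.

Lemma pts_scaleA a b x : pts_scale a (pts_scale b x) = pts_scale (a * b) x.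
Proof. by rewrite /pts_scale rmorphM skew_actM. Qed.
Lemma pts_scale1 : left_id 1 pts_scale.
Proof. by move=> x; rewrite /pts_scale rmorph1 skew_act1. Qed.
Lemma pts_scaleDr : right_distributive pts_scale +%R.
Proof. by move=> a x y; rewrite /pts_scale skew_actDr. Qed.
Lemma pts_scaleDl x : {morph pts_scale^~ x : a b / a + b}.
Proof. by move=> a b; rewrite /pts_scale rmorphD skew_actDl. Qed.

HB.instance Definition _ := GRing.Zmodule_isLmodule.Build A M
  pts_scaleA pts_scale1 pts_scaleDr pts_scaleDl.

Definition frobenius : skew_poly L := tau L ^+ \dim {:L}.

Definition frob (x : M) : M := skew_act iota frobenius x.

Lemma frobenius_comm (f : skew_poly L) : frobenius * f = f * frobenius.
Proof.
apply: scoef_inj => k; rewrite scoef_mul scoef_mul_rev.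
have cardL (c : L) : c ^+ (q ^ \dim {:L}) = c.
  have := @expf_card (finvect_type L) c.
  by rewrite -(card_vspacef (Vector.class (finvect_type L))) card_vspace.
apply: eq_bigr => i _; rewrite /frobenius !scoef_tauX.
have [->|_] := eqVneq (i : nat) (\dim {:L}).
  by rewrite cardL expr1n mulrC.
by rewrite mul0r qpow0 mulr0.
Qed.

Lemma frobD : {morph frob : x y / x + y}.
Proof. exact: skew_actDr. Qed.

Lemma frobZ a : {morph frob : x / a *: x}.
Proof. by move=> x; rewrite /frob /GRing.scale /= /pts_scale -!skew_actM frobenius_comm. Qed.

Section Tate.
Variable l : prime_poly F.

(* T_l(Phi) = inverse limit of the Phi[l^k], x k being the component in Phi[l^k] *)
Definition tate_pred : {pred nat -> M} := fun x =>
  `[< forall k, prime_val l ^+ k *: x k = 0 /\ prime_val l *: x k.+1 = x k >].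

Lemma tate_zmod_closed : zmod_closed tate_pred.
Proof.
split=> [|x y /asboolP hx /asboolP hy]; apply/asboolP => k.
  by split; exact: scaler0.
rewrite !fctE !scalerBr; have [-> ->] := hx k; have [-> ->] := hy k.
by rewrite subrr.
Qed.

HB.instance Definition _ :=
  GRing.isZmodClosed.Build (nat -> M) tate_pred tate_zmod_closed.

Record tate := Tate { tate_seq :> nat -> M; tate_seqP : tate_seq \in tate_pred }.

HB.instance Definition _ := [isSub for tate_seq].
HB.instance Definition _ := [Choice of tate by <:].
HB.instance Definition _ := [SubChoice_isSubZmodule of tate by <:].

Lemma tate_inj (x y : tate) : (forall k, x k = y k) -> x = y.
Proof. by move=> e; apply: val_inj; apply/funext. Qed.

Lemma tate_tors (x : tate) k : prime_val l ^+ k *: x k = 0.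
Proof. by case: x => x /= /asboolP/(_ k)[]. Qed.

Lemma tate_step (x : tate) k : prime_val l *: x k.+1 = x k.
Proof. by case: x => x /= /asboolP/(_ k)[]. Qed.

Lemma tate_mod (x : tate) (a : A) k : (a %% prime_val l ^+ k) *: x k = a *: x k.
Proof.
by rewrite {2}(divp_eq a (prime_val l ^+ k)) scalerDl -scalerA tate_tors scaler0 add0r.
Qed.

Lemma tate_scaleP (u : adic l) (x : tate) : (fun k => u k *: x k) \in tate_pred.
Proof.
apply/asboolP => k; split.
  by rewrite scalerA mulrC -scalerA tate_tors scaler0.
rewrite scalerA mulrC -scalerA tate_step -[in RHS](adic_step u) tate_mod //.
Qed.
Definition tate_scale u x : tate := Tate (tate_scaleP u x).

Lemma tate_scaleA u v x : tate_scale u (tate_scale v x) = tate_scale (u * v) x.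
Proof. by apply: tate_inj => k /=; rewrite tate_mod scalerA. Qed.
Lemma tate_scale1 : left_id 1 tate_scale.
Proof. by move=> x; apply: tate_inj => k /=; rewrite tate_mod scale1r. Qed.
Lemma tate_scaleDr : right_distributive tate_scale +%R.
Proof. by move=> u x y; apply: tate_inj => k; exact: scalerDr. Qed.
Lemma tate_scaleDl x : {morph tate_scale^~ x : u v / u + v}.
Proof. by move=> u v; apply: tate_inj => k; exact: scalerDl. Qed.

HB.instance Definition _ := GRing.Zmodule_isLmodule.Build (adic l) tate
  tate_scaleA tate_scale1 tate_scaleDr tate_scaleDl.

Lemma tate_frobP (x : tate) : (fun k => frob (x k)) \in tate_pred.
Proof.
apply/asboolP => k; rewrite -!frobZ tate_tors tate_step.
by split=> //; exact: skew_act0r.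
Qed.
Definition tate_frob (x : tate) : tate := Tate (tate_frobP x).

Lemma tate_frob_linear : linear tate_frob.
Proof. by move=> u x y; apply: tate_inj => k; exact: etrans (frobD _ _) (congr1 (+%R^~ _) (frobZ _ _)). Qed.

HB.instance Definition _ :=
  GRing.isLinear.Build (adic l) tate tate *:%R tate_frob tate_frob_linear.
End Tate.
End Points.
End Drinfeld.

Section CharPoly.
Variables (R : comNzRingType) (V : lmodType R).

Definition is_basis n (e : 'I_n -> V) : Prop :=
  forall v : V, exists! a : 'rV[R]_n, v = \sum_(i < n) a 0 i *: e i.

(* V is free of finite rank and p is the characteristic polynomial of f *)
Definition has_char_poly (f : {linear V -> V}) (p : {poly R}) : Prop :=
  exists (n : nat) (e : 'I_n -> V) (M : 'M[R]_n),
    [/\ is_basis e, forall j, f (e j) = \sum_(i < n) M i j *: e i & char_poly M = p].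
End CharPoly.

Section FrobeniusCharPoly.
Variables (F : finFieldType) (L : fieldExtType F).
Variable gamma : {lrmorphism {poly F} -> L}.
Variables (P : {poly F}) (Phi : drinfeld2 gamma).
Variables (Lbar : closedFieldType) (iota : {rmorphism L -> Lbar}).

(* Lbar is to be an algebraic closure of L (integralRange iota). *)
Definition supersingular : Prop := forall x : pts Phi iota, P *: x = 0 -> x = 0.
Definition ordinary : Prop := ~ supersingular.

(* The polynomial p over A is the characteristic polynomial of Frobenius on the
   Tate module at every prime l <> P. *)
Definition is_frobenius_char_poly (p : {poly {poly F}}) : Prop :=
  forall l : prime_poly F, prime_val l <> P ->
    has_char_poly (tate_frob (Phi := Phi) (iota := iota) (l := l)) (map_poly (adic_of l) p).
End FrobeniusCharPoly.

(* Main.v *)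
(* Since Phi_a has tau-degree 2 deg a, the a-torsion of Phi in any extension of
   L has at most q^(2 deg a) elements; so a direct sum of three cyclic modules
   A/(d1) + A/(d2) + A/(d3) with d3 | d2 | d1 embeds in L^Phi only if d3 is a
   unit, and L^Phi = A/(i1) + A/(i2). If a | i2, then the bound is reached
   already by the points in L. It is not reached for a = P, as Phi_P is
   inseparable, so P does not divide i2. If l^k | i2 with l <> P prime, then
   Frobenius is trivial on Phi[l^k], so it is the identity modulo l^k on the
   Tate module at l, and comparing traces gives c = 2 modulo l^k. *)
Require Import Defs.
From HB Require Import structures.
From mathcomp Require Import all_boot all_algebra falgebra fieldext finfield.
From mathcomp Require Import zify ring boolp.

Set Implicit Arguments.
Unset Strict Implicit.
Unset Printing Implicit Defensive.

Import GRing.Theory.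
Local Open Scope ring_scope.

(** * Prime factorization of polynomials over a field *)

Section PolyFactor.
Variable F : fieldType.
Implicit Types a b d p : {poly F}.

Lemma irreducible_factor a : (1 < size a)%N ->
  exists2 p, p \is monic /\ irreducible_poly p & p %| a.
Proof.
have [n] := ubnP (size a); elim: n a => // n IH a lt_n sz_a.
have a0 : a != 0 by rewrite -size_poly_gt0 ltnW.
have [irr|nirr] := pselect (irreducible_poly a).
  have la0 : (lead_coef a)^-1 != 0 by rewrite invr_eq0 lead_coef_eq0.
  exists ((lead_coef a)^-1 *: a); last by rewrite dvdpZl.
  split; first by rewrite monicE lead_coefZ mulVf ?lead_coef_eq0.
  case: irr => _ irr; split=> [|d d1]; rewrite ?size_scale // dvdpZr // => /irr-/(_ d1) e.
  by rewrite (eqp_trans e) // eqp_sym eqp_scale.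
have [d [d1 da ne]] : exists d, [/\ size d != 1, d %| a & ~~ (d %= a)].
  apply: contrapT => no; apply: nirr; split=> // d d1 da.
  by apply: contrapT => /negP ne; apply: no; exists d.
have d0 : d != 0 := dvdpN0 da a0.
have ltda : (size d < size a)%N.
  by rewrite ltn_neqAle dvdp_leq // andbT dvdp_size_eqp.
have gtd1 : (1 < size d)%N by rewrite ltn_neqAle eq_sym d1 size_poly_gt0.
have [|p hp pd] := IH d _ gtd1; first exact: leq_trans ltda _.
by exists p => //; exact: dvdp_trans da.
Qed.

Lemma factor_multiplicity p a : (1 < size p)%N -> a != 0 ->
  exists k b, a = p ^+ k * b /\ ~~ (p %| b).
Proof.
move=> sz_p; have [n] := ubnP (size a); elim: n a => // n IH a lt_n a0.
have [/dvdpP[b e]|] := boolP (p %| a); last by exists 0, a; rewrite mul1r.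
have p0 : p != 0 by rewrite -size_poly_gt0 ltnW.
have b0 : b != 0 by apply: contraNneq a0 => b0; rewrite e b0 mul0r.
have [|k [c [ec nc]]] := IH b _ b0.
  rewrite -ltnS (leq_trans _ lt_n) // e size_mul // ltnS.
  by case: (size p) sz_p => [|[|s]] // _; rewrite !addnS ltnS leq_addr.
by exists k.+1, c; rewrite e ec exprSr mulrAC.
Qed.

Lemma irreducible_coprimep p a : irreducible_poly p -> ~~ (p %| a) -> coprimep p a.
Proof.
move=> [sz_p irr] npa; rewrite coprimep_def; apply: contraT => /irr.
by move=> /(_ (dvdp_gcdl _ _)) /eqp_dvdl e; rewrite -e dvdp_gcdr in npa.
Qed.

(** Split [a] as [p ^+ k * u] with [p] prime to [u]. If [p ^+ k] divides [b], then by coprimality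
    [u] does not, and induction applies to [u], which has smaller degree. *)
Lemma Ndvdp_prime_power a b : a != 0 -> ~~ (a %| b) ->
  exists p k, [/\ p \is monic, irreducible_poly p, p ^+ k %| a & ~~ (p ^+ k %| b)].
Proof.
have [n] := ubnP (size a); elim: n a => // n IH a lt_n a0 nab.
have sz_a : (1 < size a)%N.
  rewrite ltn_neqAle size_poly_gt0 a0 andbT; apply: contra nab => /eqP e.
  by rewrite (eqp_dvdl _ (_ : a %= 1)) ?dvd1p // -size_poly_eq1 -e.
have [p [mp irr] pa] := irreducible_factor sz_a.
have sz_p := irr.1.
have [k [u [e npu]]] := factor_multiplicity sz_p a0.
have cop : coprimep (p ^+ k) u by apply/coprimep_expl/irreducible_coprimep.
have [pkb|npkb] := boolP (p ^+ k %| b); last first.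
  by exists p, k; rewrite e dvdp_mulIl.
have k0 : (0 < k)%N by rewrite lt0n; apply: contraNneq npu => k0; rewrite e k0 mul1r in pa.
have nub : ~~ (u %| b) by apply: contra nab => ub; rewrite e Gauss_dvdp // pkb.
have u0 : u != 0 by apply: contraNneq a0 => u0; rewrite e u0 mulr0.
have [|p' [k' [m' i' d' n']]] := IH u _ u0 nub; last first.
  by exists p', k'; split=> //; rewrite e dvdp_mull.
rewrite -ltnS (leq_trans _ lt_n) // ltnS e size_monicM ?monic_exp //.
have : (0 < (size (p ^+ k)%R).-1)%N by rewrite size_exp muln_gt0 k0 andbT -ltnS prednK // ltnW.
by case: (size _) => [|[|s]] // _; rewrite !addSn ltnS /= leq_addl.
Qed.
End PolyFactor.

(** * Modules of bounded exponent over a polynomial ring *)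

Section TorsionModule.
Variables (F : fieldType) (M : lmodType {poly F}).
Implicit Types (N : M -> Prop) (a b c d : {poly F}) (x y z w : M).

Definition submodule N : Prop := N 0 /\ forall a x y, N x -> N y -> N (a *: x + y).

(* d generates the annihilator of the class of z in M / N *)
Definition conductor N z d : Prop := forall a, N (a *: z) <-> d %| a.

Lemma submodule_scale N a x : submodule N -> N x -> N (a *: x).
Proof. by move=> [N0 NP] Nx; rewrite -[_ *: _]addr0; exact: NP. Qed.

Lemma submodule_add N x y : submodule N -> N x -> N y -> N (x + y).
Proof. by move=> [_ NP] Nx Ny; rewrite -[x]scale1r; exact: NP. Qed.

Lemma submodule_addl N x y : submodule N -> N x -> N (x + y) <-> N y.
Proof.
move=> sN Nx; split=> [Nxy|]; last exact: submodule_add.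
by rewrite -[y](addKr x) -scaleN1r; apply: submodule_add => //; exact: submodule_scale.
Qed.

(** A nonzero multiplier of least size that sends [z] into [N] divides all the others, by Euclidean
    division; [e] ensures that there is one. *)
Lemma conductor_exists N e z : submodule N -> e != 0 -> N (e *: z) ->
  exists d, conductor N z d.
Proof.
move=> sN e0 Nez.
pose good n := `[< exists a, [/\ a != 0, N (a *: z) & size a = n] >].
have ex_good : exists n, good n by exists (size e); apply/asboolP; exists e.
case: (ex_minnP ex_good) => n /asboolP[d [d0 Ndz sz_d]] min_n.
exists d => a; split=> [Naz|/dvdpP[b ->]]; last first.
  by rewrite -scalerA; exact: submodule_scale.
apply: contraT => nda; have r0 : a %% d != 0 by [].
have /min_n : good (size (a %% d)).
  apply/asboolP; exists (a %% d); split=> //.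
  move: Naz; rewrite {1}(divp_eq a d) scalerDl -scalerA.
  by rewrite submodule_addl //; exact: submodule_scale.
by rewrite leqNgt -sz_d ltn_modp d0.
Qed.

(** This is the analogue of the fact that the largest order of an element of a finite abelian group
    is its exponent: a conductor of maximal degree annihilates M / N. *)
Lemma max_conductor N e : submodule N -> e != 0 -> (forall z, N (e *: z)) ->
  exists x d, conductor N x d /\ forall y, N (d *: y).
Proof.
move=> sN e0 Ne.
pose good n := `[< exists x d, conductor N x d /\ size d = n >].
have ex_good : exists n, good n.
  have [d cd] := conductor_exists sN e0 (Ne 0).
  by exists (size d); apply/asboolP; exists 0, d.
have cond_dvd x d : conductor N x d -> d %| e by move=> cd; apply/cd.
have ub_good n : good n -> (n <= size e)%N.
  by move=> /asboolP[x [d [/cond_dvd de <-]]]; exact: dvdp_leq.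
case: (ex_maxnP ex_good ub_good) => n /asboolP[x [f [cf sz_f]]] max_n.
exists x, f; split=> // y.
have [g cg] := conductor_exists sN e0 (Ne y).
apply/cg; apply: contraT.
have g0 : g != 0 := dvdpN0 (cond_dvd _ _ cg) e0.
have f0 : f != 0 := dvdpN0 (cond_dvd _ _ cf) e0.
(* If g does not divide f, trade the p-part of x for the larger p-part of y. *)
move=> /(Ndvdp_prime_power g0)[p [k [_ irr /dvdpP[v eg] npf]]].
have [j [u [ef npu]]] := factor_multiplicity irr.1 f0.
have cop : coprimep (p ^+ k) u by apply/coprimep_expl/irreducible_coprimep.
have v0 : v != 0 by apply: contraNneq g0 => v0; rewrite eg v0 mul0r.
have p0 : p != 0 := irredp_neq0 irr.
(* Modulo [N], the vectors [p ^+ j *: x] and [v *: y] have the coprime conductors [u] and [p ^+ k],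
   so the conductor of their sum is a multiple of the product. Multiplying by one conductor isolates
   the other vector. *)
have [h ch] := conductor_exists sN e0 (Ne (p ^+ j *: x + v *: y)).
have : p ^+ k * u %| h.
  have Nh : N (h *: (p ^+ j *: x + v *: y)) by apply/ch.
  rewrite Gauss_dvdp //; apply/andP; split.
    have eu : u *: (h *: (p ^+ j *: x + v *: y)) = (h * f) *: x + (h * u * v) *: y.
      by rewrite ef !scalerDr !scalerA; congr (_ *: x + _ *: y); ring.
    have : N ((h * u * v) *: y).
      have := submodule_scale u sN Nh; rewrite eu submodule_addl //.
      by apply/cf; exact: dvdp_mulIr.
    by move/cg; rewrite eg [v * _]mulrC dvdp_mul2r // Gauss_dvdpl.
  have ep : p ^+ k *: (h *: (p ^+ j *: x + v *: y)) =
      (h * g) *: y + (h * p ^+ k * p ^+ j) *: x.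
    by rewrite eg addrC !scalerDr !scalerA; congr (_ *: y + _ *: x); ring.
  have : N ((h * p ^+ k * p ^+ j) *: x).
    have := submodule_scale (p ^+ k) sN Nh; rewrite ep submodule_addl //.
    by apply/cg; exact: dvdp_mulIr.
  move/cf; rewrite ef [p ^+ j * _]mulrC dvdp_mul2r ?expf_neq0 // Gauss_dvdpl //.
  by rewrite coprimep_sym.
have h0 : h != 0 := dvdpN0 (cond_dvd _ _ ch) e0.
move/(dvdp_leq h0); have : (size h <= n)%N.
  by apply: max_n; apply/asboolP; exists (p ^+ j *: x + v *: y), h.
have u0 : u != 0 by apply: contraNneq f0 => u0; rewrite ef u0 mulr0.
(* Since [p ^+ k] does not divide [f = p ^+ j * u], [j < k]; so [h] has larger degree than [f],
   against maximality. *)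
have lt_jk : (j < k)%N.
  rewrite ltnNge; apply: contra npf => le_kj.
  by rewrite ef dvdp_mulr // dvdp_exp2l.
move=> le1 le2; have := leq_trans le2 le1; rewrite -sz_f ef.
rewrite -(subnK (ltnW lt_jk)) exprD -mulrA leqNgt [size (p ^+ (k - j) * _)]size_mul ?mulf_neq0 ?expf_neq0 //.
have : (0 < (size (p ^+ (k - j))%R).-1)%N.
  rewrite size_exp muln_gt0 subn_gt0 lt_jk andbT -ltnS prednK; first exact: irr.1.
  by rewrite size_poly_gt0.
case: (size (p ^+ (k - j))%R) => [|[|s]] // _.
by rewrite !addSn /= ltnS leq_addl.
Qed.

(** Apply [max_conductor] to 0, to Ax and to Ax + Ay. Each new generator is then corrected by an
    element of the preceding submodule, so that its conductor annihilates it. *)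
Lemma cyclic_summands e : e != 0 -> (forall w, e *: w = 0) ->
  exists x y z d1 d2 d3,
    [/\ [/\ d1 != 0, d2 %| d1 & d3 %| d2],
        [/\ d1 *: x = 0, d2 *: y = 0 & d3 *: z = 0],
        forall a b c, a *: x + b *: y + c *: z = 0 -> [/\ d1 %| a, d2 %| b & d3 %| c]
      & forall w, exists a b, d3 *: w = a *: x + b *: y].
Proof.
move=> e0 eM.
have s0 : submodule (fun w => w = 0).
  by split=> // a x y -> ->; rewrite scaler0 addr0.
have [x [d1 [c1 k1]]] := max_conductor s0 e0 eM.
have d1_neq0 : d1 != 0 by apply: dvdpN0 e0; apply/c1.
have s1 : submodule (fun w => exists a, w = a *: x).
  split; first by exists 0; rewrite scale0r.
  by move=> a _ _ [b ->] [b' ->]; exists (a * b + b'); rewrite scalerDl scalerA.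
have [|y0 [d2 [c2 k2]]] := max_conductor s1 e0.
  by move=> w; exists 0; rewrite eM scale0r.
have [f1 ef1] : exists f, d1 = f * d2.
  by apply/dvdpP/c2; exists 0; rewrite k1 scale0r.
have f1_neq0 : f1 != 0 by apply: contraNneq d1_neq0 => f0; rewrite ef1 f0 mul0r.
have d2_neq0 : d2 != 0 by apply: contraNneq d1_neq0 => f0; rewrite ef1 f0 mulr0.
(* From [d2 *: y0 = b *: x], multiplication by [f1] gives [(f1 * b) *: x = d1 *: y0 = 0]. Hence
   [d1 = f1 * d2] divides [f1 * b], so [d2] divides [b], and [y0] can be corrected by a multiple of
   [x]. *)
have [b eb] := k2 y0.
have /dvdpP[b' eb'] : d2 %| b.
  rewrite -(dvdp_mul2l _ _ f1_neq0) -ef1; apply/c1.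
  by rewrite -scalerA -eb scalerA -ef1.
have [y [ey c2']] : exists y, d2 *: y = 0 /\
    conductor (fun w => exists a, w = a *: x) y d2.
  exists (y0 - b' *: x); split.
    by rewrite scalerBr scalerA eb eb' [d2 * _]mulrC subrr.
  move=> a; apply: iff_trans (c2 a); rewrite scalerBr addrC.
  by apply: (submodule_addl _ s1); exists (- (a * b')); rewrite scaleNr scalerA.
have s2 : submodule (fun w => exists a b, w = a *: x + b *: y).
  split; first by exists 0, 0; rewrite !scale0r addr0.
  move=> a _ _ [u [v ->]] [u' [v' ->]]; exists (a * u + u'), (a * v + v').
  by rewrite scalerDr !scalerDl !scalerA addrACA.
have [|z0 [d3 [c3 k3]]] := max_conductor s2 e0.
  by move=> w; exists 0, 0; rewrite eM !scale0r addr0.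
have [f2 ef2] : exists f, d2 = f * d3.
  apply/dvdpP/c3; have [a ea] := k2 z0.
  by exists a, 0; rewrite ea scale0r addr0.
have f2_neq0 : f2 != 0 by apply: contraNneq d2_neq0 => f0; rewrite ef2 f0 mul0r.
have [al [be ez]] := k3 z0.
(* Multiplying the relation for [d3 *: z0] by [f2] puts [(f2 * be) *: y] in Ax, because [d2] sends
   everything into Ax. *)
have /dvdpP[be' ebe] : d3 %| be.
  rewrite -(dvdp_mul2l _ _ f2_neq0) -ef2; apply/c2'.
  have [g eg] := k2 z0; exists (g - f2 * al).
  rewrite scalerBl -eg ef2 -[(f2 * d3) *: z0]scalerA ez scalerDr -!scalerA.
  by rewrite [RHS]addrC addKr.
(* Multiplication by [f1 * f2] turns [d3 *: z0] into [d1 *: z0 = 0] and also kills the term in [y],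
   leaving a relation on [x] alone. *)
have /dvdpP[al' eal] : d3 %| al.
  rewrite -(dvdp_mul2l _ _ (mulf_neq0 f1_neq0 f2_neq0)) -mulrA -ef2 -ef1; apply/c1.
  have := k1 z0; rewrite {1}ef1 {1}ef2 mulrA -scalerA ez scalerDr !scalerA.
  suff -> : (f1 * f2 * be) *: y = 0 by rewrite addr0.
  have -> : f1 * f2 * be = f1 * be' * d2 by rewrite ebe ef2; ring.
  by rewrite -scalerA ey scaler0.
pose z := z0 - (al' *: x + be' *: y).
have ezz : d3 *: z = 0.
  by rewrite scalerBr ez scalerDr !scalerA eal ebe ![d3 * _]mulrC subrr.
exists x, y, z, d1, d2, d3; split=> //.
  by split=> //; [rewrite ef1 | rewrite ef2]; exact: dvdp_mulIr.
(* The coefficients are treated from the last to the first: once one is known to be divisible, its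
   term vanishes. *)
move=> a u c e1.
have dc : d3 %| c.
  apply/c3; exists (c * al' - a), (c * be' - u).
  have ez0 : c *: z0 = c *: z + c *: (al' *: x + be' *: y) by rewrite -scalerDr subrK.
  have -> : c *: z0 = c *: (al' *: x + be' *: y) - (a *: x + u *: y).
    rewrite ez0 addrC; congr (_ + _); apply/eqP.
    by rewrite -addr_eq0 addrC e1.
  by rewrite scalerDr !scalerBl !scalerA opprD addrACA.
have du : d2 %| u.
  apply/c2'; exists (- a); rewrite scaleNr; apply/eqP; rewrite -addr_eq0 addrC.
  case/dvdpP: dc e1 => t ->; rewrite -scalerA ezz scaler0 addr0 => ->.
  by [].
split=> //; apply/c1; case/dvdpP: dc e1 => t ->; rewrite -scalerA ezz scaler0 addr0.
by case/dvdpP: du => t' ->; rewrite -scalerA ey scaler0 addr0.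
Qed.
End TorsionModule.

(** The [x k] span a copy of (A/(d))^r. Its elements are listed by the matrices whose rows are the
    coefficients of polynomials of degree less than deg d. *)
Lemma independent_torsion_count (F : finFieldType) (M : lmodType {poly F})
    (r : nat) (x : 'I_r -> M) (d : {poly F}) :
  d != 0 -> (forall k, d *: x k = 0) ->
  (forall a : 'I_r -> {poly F}, \sum_k a k *: x k = 0 -> forall k, d %| a k) ->
  exists s : seq M, [/\ uniq s, size s = (#|F| ^ (r * (size d).-1))%N
                      & forall w, w \in s -> d *: w = 0].
Proof.
move=> d0 dx indep.
pose f (B : 'M[F]_(r, (size d).-1)) := \sum_k rVpoly (row k B) *: x k.
exists [seq f B | B <- enum 'M[F]_(r, (size d).-1)]; split.
- rewrite map_inj_uniq ?enum_uniq // => B B' /eqP.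
  rewrite -subr_eq0 -sumrB => /eqP.
  under eq_bigr do rewrite -scalerBl.
  move=> /indep dvd; apply/row_matrixP => k; apply: (can_inj (@rVpolyK _ _)).
  apply/eqP; rewrite -subr_eq0; apply: contraT => nz.
  have := dvdp_leq nz (dvd k); rewrite leqNgt => /negP[].
  rewrite -linearB /= (leq_ltn_trans (size_poly _ _)) //.
  by rewrite prednK // size_poly_gt0.
- by rewrite size_map -cardE card_mx.
move=> _ /mapP[B _ ->]; rewrite scaler_sumr big1 // => k _.
by rewrite scalerA mulrC -scalerA dx scaler0.
Qed.

(** * Direct sums of two cyclic modules and their torsion *)

Section TwoGenerators.
Variables (F : finFieldType) (M : lmodType {poly F}).
Implicit Types (a b d : {poly F}) (x y w : M).

(* M is the internal direct sum of Ax = A/(d1) and Ay = A/(d2) *)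
Definition direct_sum2 x y d1 d2 : Prop :=
  [/\ d1 *: x = 0, d2 *: y = 0,
      forall a b, a *: x + b *: y = 0 -> d1 %| a /\ d2 %| b
    & forall w, exists a b, w = a *: x + b *: y].

(** In [cyclic_summands], suitable multiples of [x], [y], [z] generate q^(3 deg d3) elements killed
    by [d3]. The bound allows only q^(2 deg d3), so [d3] is a unit and [x], [y] generate [M]. *)
Lemma direct_sum2_exists e : e != 0 -> (forall w, e *: w = 0) ->
  (forall d (s : seq M), d != 0 -> uniq s -> (forall w, w \in s -> d *: w = 0) ->
     (size s <= #|F| ^ (2 * (size d).-1))%N) ->
  exists x y d1 d2, [/\ d1 != 0, d2 %| d1 & direct_sum2 x y d1 d2].
Proof.
move=> e0 eM bound.
have [x [y [z [d1 [d2 [d3 [[d10 d21 d32] [dx dy dz] indep gen]]]]]]] :=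
  cyclic_summands e0 eM.
have d20 := dvdpN0 d21 d10; have d30 := dvdpN0 d32 d20.
have [f1 e1] : exists f, d1 = f * d3 by apply/dvdpP; exact: dvdp_trans d21.
have [f2 e2] : exists f, d2 = f * d3 by apply/dvdpP.
have f10 : f1 != 0 by apply: contraNneq d10 => f0; rewrite e1 f0 mul0r.
have f20 : f2 != 0 by apply: contraNneq d20 => f0; rewrite e2 f0 mul0r.
pose g (k : 'I_3) := [:: f1 *: x; f2 *: y; z]`_k.
have [|a|s [us sz_s ks]] := independent_torsion_count (x := g) d30.
- by move=> [[|[|[|k]]] ltk] //; rewrite /g /= ?scalerA 1?mulrC -?e1 -?e2 //.
- rewrite !big_ord_recr big_ord0 /= add0r /g /= !scalerA => /indep[].
  rewrite e1 e2 ![_ * f1]mulrC ![_ * f2]mulrC !dvdp_mul2l // => h0 h1 h2.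
  move=> [[|[|[|k]]] ltk] //; [move: h0 | move: h1 | move: h2];
    by congr (is_true (_ %| a _)); apply: val_inj.
have := bound _ _ d30 us ks; rewrite sz_s leq_exp2l ?finNzRing_gt1 // leq_mul2r /=.
rewrite orbF => /eqP sz_d3.
have /eqpP[[u v] /= /andP[u0 v0] ed3] : d3 %= 1.
  by rewrite -size_poly_eq1 -(prednK (_ : 0 < size d3)%N) ?size_poly_gt0 ?sz_d3.
exists x, y, d1, d2; split=> //; split=> // [a b eq0|w].
  by have [|] := indep a b 0; rewrite // scale0r addr0.
have [a [b eab]] := gen w; exists ((v^-1 * u)%:P * a), ((v^-1 * u)%:P * b).
rewrite -!scalerA -scalerDr -eab scalerA mul_polyC -scalerA ed3 scalerA mulVf //.
by rewrite !scale1r.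
Qed.

(** The multiples of [x] by d1/d and of [y] by d2/d span a copy of (A/(d))^2. *)
Lemma direct_sum2_torsion x y d1 d2 d : d1 != 0 -> d2 %| d1 ->
  direct_sum2 x y d1 d2 -> d %| d2 ->
  exists s : seq M, [/\ uniq s, size s = (#|F| ^ (2 * (size d).-1))%N
                      & forall w, w \in s -> d *: w = 0].
Proof.
move=> d10 d21 [dx dy indep _] dd2.
have d20 := dvdpN0 d21 d10; have d0 := dvdpN0 dd2 d20.
have [f1 e1] : exists f, d1 = f * d by apply/dvdpP; exact: dvdp_trans d21.
have [f2 e2] : exists f, d2 = f * d by apply/dvdpP.
have f10 : f1 != 0 by apply: contraNneq d10 => f0; rewrite e1 f0 mul0r.
have f20 : f2 != 0 by apply: contraNneq d20 => f0; rewrite e2 f0 mul0r.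
apply: (independent_torsion_count (x := fun k : 'I_2 => [:: f1 *: x; f2 *: y]`_k)) => //.
  by move=> [[|[|k]] ltk] //=; rewrite scalerA mulrC -?e1 -?e2.
move=> a; rewrite !big_ord_recr big_ord0 /= add0r /= !scalerA => /indep[].
rewrite e1 e2 ![_ * f1]mulrC ![_ * f2]mulrC !dvdp_mul2l // => h0 h1.
move=> [[|[|k]] ltk] //; [move: h0 | move: h1];
  by congr (is_true (_ %| a _)); apply: val_inj.
Qed.

Lemma direct_sum2_iso x y d1 d2 : direct_sum2 x y d1 d2 ->
  exists f : {linear M -> (quotA d1 * quotA d2)%type}, bijective f.
Proof.
move=> [dx dy indep gen].
(* Coordinates are chosen arbitrarily; [fE] shows that their classes do not depend on the choice,
   which gives linearity. *)
have /choice[h hE] w : exists ab, w = ab.1 *: x + ab.2 *: y.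
  by have [a [b e]] := gen w; exists (a, b).
pose f w : quotA d1 * quotA d2 := (quot_pi d1 (h w).1, quot_pi d2 (h w).2).
have fE a b : f (a *: x + b *: y) = (quot_pi d1 a, quot_pi d2 b).
  have := hE (a *: x + b *: y); rewrite /f; move: (h _) => [a' b'] /= e.
  have [|da db] := indep (a' - a) (b' - b).
    by rewrite !scalerBl addrACA -opprD -e subrr.
  by congr (_, _); apply/quot_piE.
have f_lin : linear f.
  move=> c v w; rewrite [v in LHS]hE [w in LHS]hE scalerDr !scalerA addrACA -!scalerDl fE.
  by rewrite !quot_piD -!quot_scale_pi.
pose fL := GRing.isLinear.Build {poly F} M (quotA d1 * quotA d2)%type *:%R f f_lin.
pose fl : {linear M -> (quotA d1 * quotA d2)%type} := HB.pack f fL.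
pose g (u : quotA d1 * quotA d2) :=
  repr (u.1 : Quotient.quot (principal_ideal d1)) *: x +
  repr (u.2 : Quotient.quot (principal_ideal d2)) *: y.
have gK : cancel g f by move=> [u v]; rewrite fE !quot_reprK.
have f_inj : injective f.
  move=> v w [/quot_piE/dvdpP[a ea] /quot_piE/dvdpP[b eb]].
  apply/eqP; rewrite -subr_eq0 (hE v) (hE w) opprD addrACA -!scalerBl ea eb.
  by rewrite -!scalerA dx dy !scaler0 addr0.
exists fl; exists g => //.
by move=> w; apply: f_inj; rewrite gK.
Qed.
End TwoGenerators.

(** * Degrees in tau and numbers of roots *)

Section SkewDegree.
Variables (F : finFieldType) (L : fieldExtType F).
Implicit Types f g h : skew_poly L.
Local Notation q := #|F|.

Lemma scoef_ge_ssize f i : (ssize f <= i)%N -> scoef f i = 0.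
Proof. exact: nth_default. Qed.

(** The top coefficient of the product is that of [f] times a q-power of that of [g], which is
    nonzero in a field. *)
Lemma ssize_mul f g : f != 0 -> g != 0 -> ssize (f * g) = (ssize f + ssize g).-1.
Proof.
move=> f0 g0.
have sf : (0 < ssize f)%N by rewrite /ssize size_poly_gt0.
have sg : (0 < ssize g)%N by rewrite /ssize size_poly_gt0.
have [le_k top] : (forall k, ((ssize f + ssize g).-1 <= k)%N -> scoef (f * g) k = 0) /\
    scoef (f * g) ((ssize f).-1 + (ssize g).-1) != 0.
  split=> [k le_k|].
    by apply: nth_default; apply: leq_trans le_k; exact: size_poly.
  have lt_top : ((ssize f).-1 < ((ssize f).-1 + (ssize g).-1).+1)%N.
    by rewrite ltnS leq_addr.
  rewrite scoef_mul (bigD1 (Ordinal lt_top)) //= addKn big1 ?addr0.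
    by rewrite mulf_neq0 ?expf_neq0 // -[scoef _ _]/(lead_coef (_ : {poly L})) lead_coef_eq0.
  move=> i; rewrite -val_eqE /= neq_ltn => /orP[lt_i|gt_i].
    by rewrite [scoef g _]scoef_ge_ssize ?qpow0 ?mulr0 //; lia.
  by rewrite scoef_ge_ssize ?mul0r //; lia.
apply/eqP; rewrite eqn_leq; apply/andP; split; first exact: size_poly.
rewrite leqNgt; apply: contra top => lt_s; apply/eqP/scoef_ge_ssize.
by move: lt_s; lia.
Qed.

Lemma size_qpowX_sum (E : fieldType) (n : nat) (c : nat -> E) : c n != 0 ->
  size (\sum_(i < n.+1) c i *: 'X^(q ^ i)) = (q ^ n).+1.
Proof.
move=> cn0; rewrite big_ord_recr /= addrC size_polyDl size_scale ?size_polyXn //.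
rewrite ltnS; apply: leq_trans (size_sum _ _ _) _; apply/bigmax_leqP => i _.
apply: leq_trans (size_scale_leq _ _) _.
by rewrite size_polyXn ltn_exp2l ?finNzRing_gt1.
Qed.

(** The action of [f] is evaluation of a polynomial in the monomials X^(q^i), whose degree is q to
    the tau-degree of [f]. *)
Lemma skew_act_roots (E : fieldType) (iota : {rmorphism L -> E}) f (s : seq E) :
  f != 0 -> uniq s -> (forall x, x \in s -> skew_act iota f x = 0) ->
  (size s <= q ^ (ssize f).-1)%N.
Proof.
move=> f0 us sroot; have sf : (0 < ssize f)%N by rewrite /ssize size_poly_gt0.
have cf : iota (scoef f (ssize f).-1) != 0.
  by rewrite fmorph_eq0 -[scoef _ _]/(lead_coef (_ : {poly L})) lead_coef_eq0.
have sz := size_qpowX_sum (c := fun i => iota (scoef f i)) cf.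
rewrite -ltnS -sz; apply: max_poly_roots us; first by rewrite -size_poly_gt0 sz.
apply/allP => x /sroot; rewrite prednK // /root horner_sum => fx; apply/eqP.
by rewrite -[RHS]fx; apply: eq_bigr => i _; rewrite hornerZ hornerXn.
Qed.

(* If the constant term vanishes then f = h tau, and x |-> x^q is injective. *)
Lemma skew_act_roots_inseparable (E : fieldType) (iota : {rmorphism L -> E}) f (s : seq E) :
  f != 0 -> scoef f 0 = 0 -> uniq s ->
  (forall x, x \in s -> skew_act iota f x = 0) ->
  (size s <= q ^ (ssize f).-2)%N.
Proof.
move=> f0 c0 us sroot.
pose h : skew_poly L := \poly_(i < (ssize f).-1) scoef f i.+1.
have hE i : scoef h i = scoef f i.+1.
  rewrite {1}/scoef coef_poly; case: ltnP => // le_i.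
  by rewrite scoef_ge_ssize //; case: (ssize f) le_i.
have sz_f : (1 < ssize f)%N.
  rewrite ltnNge; apply: contra f0 => le1; apply/eqP/scoef_inj => -[|i].
    by rewrite c0 /scoef coef0.
  by rewrite scoef_ge_ssize /scoef ?coef0 // (leq_trans le1).
have cf : scoef f (ssize f).-1 != 0.
  by rewrite -[scoef _ _]/(lead_coef (_ : {poly L})) lead_coef_eq0.
have sz_h : ssize h = (ssize f).-1.
  by rewrite /ssize size_poly_eq // prednK // -ltnS prednK // ltnW.
have h0 : h != 0 by rewrite -size_poly_gt0 -/(ssize h) sz_h -ltnS prednK // ltnW.
(* The q-th powers of the listed roots of [f] are distinct roots of [h], whose tau-degree is one
   less. *)
rewrite -sz_h -(size_map (fun x => x ^+ q)); apply: (skew_act_roots (iota := iota)) => //.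
  rewrite map_inj_uniq // => x y /eqP.
  rewrite -subr_eq0.
  have qN : x ^+ q - y ^+ q = (x - y) ^+ q.
    have := qpowD (iota \o (GRing.in_alg L : {rmorphism F -> L})) 1 (x - y) y.
    by rewrite expn1 subrK => ->; rewrite addrK.
  by rewrite qN expf_eq0 subr_eq0 => /andP[_ /eqP].
move=> _ /mapP[x /sroot fx ->]; rewrite -[RHS]fx.
rewrite (skew_actE _ _ (leqnn (ssize f))) (skew_actE _ _ (leqnn (ssize h))) sz_h.
rewrite -[ssize f in RHS](prednK (ltnW sz_f)) big_nat_recl // c0 rmorph0 mul0r add0r.
by apply: eq_bigr => i _; rewrite hE -exprM -expnS.
Qed.
End SkewDegree.

(** * Torsion points of a Drinfeld module of rank 2 *)

Section DrinfeldPoints.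
Variables (F : finFieldType) (L : fieldExtType F).
Variables (gamma : {lrmorphism {poly F} -> L}) (Phi : drinfeld2 gamma).
Implicit Type a : {poly F}.
Local Notation q := #|F|.

(** Phi_a has tau-degree 2 deg a: in passing from [a] to [a * 'X + c], the factor Phi_T adds 2, and
    Phi_c is a constant. *)
Lemma ssize_dmap a : a != 0 -> ssize (Phi a) = (2 * (size a).-1).+1.
Proof.
have ssizeC (c : F) : (ssize (Phi c%:P) <= 1)%N.
  rewrite -[c%:P]mulr1 mul_polyC linearZ /= rmorph1.
  rewrite /GRing.scale /= /skew_scale mulr1; exact: size_polyC_leq1.
have sX : ssize (Phi 'X) = 3%N.
  have [a1 [a2 [a20 ->]]] := dmap_rank2 Phi.
  have c i : scoef (skewC (gamma 'X) + skewC a1 * tau L + skewC a2 * tau L ^+ 2) i =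
      if i == 0%N then gamma 'X else if i == 1%N then a1 else if i == 2%N then a2 else 0.
    rewrite !scoefD !scoef_mulCl scoefC scoef_tauX -[tau L]expr1 scoef_tauX.
    by case: i => [|[|[|i]]] //=; rewrite ?mulr0 ?mulr1 ?addr0 ?add0r.
  apply/eqP; rewrite eqn_leq; apply/andP; split.
    by apply/leq_sizeP => -[|[|[|j]]] // _; apply: c.
  by rewrite ltnNge; apply: contra a20 => /leq_sizeP/(_ 2 isT) e; have := c 2; rewrite /scoef e /= => <-.
elim/poly_ind: a => [/eqP//|a c IH] n0.
have [a0|a0] := eqVneq a 0.
  move: n0; rewrite a0 mul0r add0r => c0; rewrite size_polyC -polyC_eq0 c0 /=.
  apply/eqP; rewrite eqn_leq ssizeC /ssize size_poly_gt0.
  move: c0; rewrite polyC_eq0 => c0.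
  rewrite -[c%:P]mulr1 mul_polyC linearZ /= rmorph1.
  by rewrite /GRing.scale /= /skew_scale mulr1 /skewC polyC_eq0 -in_algE fmorph_eq0.
have sa := IH a0.
have Phia0 : Phi a != 0 by rewrite -size_poly_gt0 -/(ssize (Phi a)) sa.
have PhiX0 : Phi 'X != 0 by rewrite -size_poly_gt0 -/(ssize (Phi 'X)) sX.
have sM : ssize (Phi (a * 'X)) = (2 * (size a).-1 + 3)%N.
  by rewrite rmorphM ssize_mul // sa sX.
rewrite rmorphD /ssize size_polyDl; last first.
  by rewrite -!/(ssize _) sM (leq_ltn_trans (ssizeC c)) // addnC.
rewrite -/(ssize _) sM size_MXaddC (negbTE a0) /=.
have : (0 < size a)%N by rewrite size_poly_gt0.
by case: (size a) => // n _; rewrite /= mulnS !addnS addn0 add2n.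
Qed.

Lemma dmap_neq0 a : a != 0 -> Phi a != 0.
Proof. by move=> a0; rewrite -size_poly_gt0 -/(ssize (Phi a)) ssize_dmap. Qed.

Lemma torsion_bound (E : fieldType) (iota : {rmorphism L -> E}) a (s : seq (pts Phi iota)) :
  a != 0 -> uniq s -> (forall x, x \in s -> a *: x = 0) ->
  (size s <= q ^ (2 * (size a).-1))%N.
Proof.
move=> a0 us sa; have -> : (2 * (size a).-1 = (ssize (Phi a)).-1)%N by rewrite ssize_dmap.
exact: skew_act_roots (dmap_neq0 a0) us sa.
Qed.

Lemma torsion_bound_char (E : fieldType) (iota : {rmorphism L -> E}) a (s : seq (pts Phi iota)) :
  a != 0 -> gamma a = 0 -> uniq s -> (forall x, x \in s -> a *: x = 0) ->
  (size s <= q ^ (2 * (size a).-1).-1)%N.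
Proof.
move=> a0 ga us sa.
have -> : ((2 * (size a).-1).-1 = (ssize (Phi a)).-2)%N by rewrite ssize_dmap.
by apply: skew_act_roots_inseparable (dmap_neq0 a0) _ us sa; rewrite dmap_const.
Qed.

(** Pigeonhole: there are [N] maps from L to L but q^N > N polynomials of degree less than [N], so
    two of these act in the same way, and their difference kills L. *)
Lemma exponent_exists :
  exists2 e : {poly F}, e != 0 &
    forall x : pts Phi (idfun : {rmorphism L -> L}), e *: x = 0.
Proof.
pose T : finType := finvect_type L.
pose N := #|{ffun T -> T}|.
pose h (v : 'rV[F]_N) : {ffun T -> T} :=
  [ffun x : T => rVpoly v *: (x : pts Phi (idfun : {rmorphism L -> L}))].
have : ~ injective h.
  move=> /leq_card; rewrite card_mx mul1n leqNgt ltn_expl //.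
  exact: finNzRing_gt1.
move/injectiveP/injectivePn => [u [v ne /ffunP e]].
exists (rVpoly u - rVpoly v); last first.
  by move=> x; have := e x; rewrite !ffunE scalerBl => ->; rewrite subrr.
by rewrite subr_eq0 (can_eq (@rVpolyK _ _)).
Qed.

Section Geometric.
Variables (E : fieldType) (iota : {rmorphism L -> E}).

Lemma pts_rmorph a (x : L) :
  a *: (iota x : pts Phi iota) =
  iota (a *: (x : pts Phi (idfun : {rmorphism L -> L}))).
Proof.
rewrite /GRing.scale /= /pts_scale /skew_act rmorph_sum.
by apply: eq_bigr => i _; rewrite rmorphM rmorphXn.
Qed.

Lemma frob_rmorph (x : L) : frob (iota x : pts Phi iota) = iota x.
Proof.
rewrite /frob skew_act_tauX -rmorphXn; congr (iota _).
have := @expf_card (finvect_type L) x.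
by rewrite -(card_vspacef (Vector.class (finvect_type L))) card_vspace.
Qed.

(** L already contains as many [a]-torsion points as an extension can have. So all those in [E] come
    from L, where Frobenius is the identity. *)
Lemma frob_torsion a (s : seq L) (x : pts Phi iota) :
  a != 0 -> uniq s -> (q ^ (2 * (size a).-1) <= size s)%N ->
  (forall y, y \in s -> a *: (y : pts Phi (idfun : {rmorphism L -> L})) = 0) ->
  a *: x = 0 -> frob x = x.
Proof.
move=> a0 us sz_s sa ax.
have [/mapP[y _ ->]|nx] := boolP (x \in map iota s); first exact: frob_rmorph.
suff : (size (x :: map iota s) <= q ^ (2 * (size a).-1))%N.
  by rewrite /= size_map => lt; have := leq_trans lt sz_s; rewrite ltnn.
apply: (torsion_bound (iota := iota) a0) => /=.
  by rewrite nx map_inj_uniq //; exact: fmorph_inj.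
move=> z; rewrite inE => /orP[/eqP-> //|/mapP[y /sa ay ->]].
by rewrite pts_rmorph ay; exact: rmorph0.
Qed.
End Geometric.
End DrinfeldPoints.

(** * The trace of Frobenius on a Tate module *)

Section Tate.
Variables (F : finFieldType) (L : fieldExtType F).
Variables (gamma : {lrmorphism {poly F} -> L}) (Phi : drinfeld2 gamma).
Variables (E : fieldType) (iota : {rmorphism L -> E}) (l : prime_poly F).
Local Notation T := (tate Phi iota l).

Lemma tate_shift (x : T) j k : prime_val l ^+ j *: x (j + k)%N = x k.
Proof.
elim: j => [|j IH]; first by rewrite scale1r.
by rewrite exprSr -scalerA addSn tate_step.
Qed.

(** The quotient by l^k is the shifted sequence with terms [x (k + j)]; its j-th term is killed by
    l^j because [x k = 0]. *)
Lemma tate_divisible (x : T) k : x k = 0 ->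
  exists y : T, x = adic_of l (prime_val l ^+ k) *: y.
Proof.
move=> xk0.
have yP : (fun j => x (k + j)%N) \in @tate_pred _ _ _ Phi _ iota l.
  apply/asboolP => j; rewrite addnC tate_shift xk0; split=> //.
  by rewrite addnS tate_step addnC.
exists (Tate yP); apply: tate_inj => j.
by rewrite -[RHS]/((_ %% prime_val l ^+ j) *: (Tate yP) j) tate_mod /= tate_shift.
Qed.

(** Frobenius is the identity modulo l^k on the Tate module, so its trace, which is minus the
    coefficient of X in [p], is 2 modulo l^k. *)
Lemma frobenius_trace_dvd (p : {poly {poly F}}) k :
  has_char_poly (tate_frob (Phi := Phi) (iota := iota) (l := l)) (map_poly (adic_of l) p) ->
  p \is monic -> size p = 3%N ->
  (forall x : pts Phi iota, prime_val l ^+ k *: x = 0 -> frob x = x) ->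
  prime_val l ^+ k %| p`_1 + 2%:R.
Proof.
move=> [n [e [M [basis_e Me eM]]]] mp sz_p frob_id.
have n2 : n = 2%N.
  apply: succn_inj; rewrite -(size_char_poly M) eM -sz_p.
  by rewrite size_map_poly_id0 // (monicP mp) rmorph1 oner_neq0.
subst n.
have /choice[y yE] j : exists y, tate_frob (e j) - e j = adic_of l (prime_val l ^+ k) *: y.
  apply: tate_divisible; apply/eqP; rewrite subr_eq0; apply/eqP.
  by apply: frob_id; exact: tate_tors.
have /choice[b bE] j : exists b : 'rV_2, y j = \sum_i b 0 i *: e i.
  by have [b [hb _]] := basis_e (y j); exists b.
(* Uniqueness of coordinates turns the congruence of vectors into a congruence of matrices: [M] is
   the identity modulo l^k. *)
have ME i j : M i j = (i == j)%:R + adic_of l (prime_val l ^+ k) * b j 0 i.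
  have [a [_ uniq_a]] := basis_e (tate_frob (e j)).
  pose a1 : 'rV_2 := \row_i M i j.
  pose a2 : 'rV_2 := \row_i ((i == j)%:R + adic_of l (prime_val l ^+ k) * b j 0 i).
  suff ea : a1 = a2 by have := congr1 (fun r : 'rV_2 => r 0 i) ea; rewrite !mxE.
  apply: etrans (esym (uniq_a a1 _)) (uniq_a a2 _).
    by rewrite Me; apply: eq_bigr => i' _; rewrite mxE.
  rewrite -[LHS](subrK (e j)) yE bE scaler_sumr addrC.
  under [RHS]eq_bigr do rewrite mxE scalerDl.
  rewrite big_split; congr (_ + _); last by under [RHS]eq_bigr do rewrite -scalerA.
  rewrite (bigD1 j) //= eqxx scale1r big1 ?addr0 // => i' /negbTE->.
  by rewrite scale0r.
have := char_poly_trace M isT; rewrite eM coef_map /= /mxtrace.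
under eq_bigr do rewrite ME eqxx.
rewrite big_split /= -mulr_sumr sumr_const card_ord => tr.
have {}tr : adic_of l (p`_1 + 2%:R) =
    adic_of l (prime_val l ^+ k) * - (\sum_i b i 0 i).
  by rewrite rmorphD rmorph_nat /= tr opprD addrAC addNr add0r mulrN.
(* At level [k] the factor l^k vanishes, so the l-adic identity becomes a divisibility in A. *)
have := congr1 (fun u : adic l => u k) tr.
by rewrite /= modp_mull2 modp_mulr => /modp_eq0P.
Qed.
End Tate.

(** * The structure of the module of points over L *)

Theorem proposition1p1
  (F : finFieldType) (L : fieldExtType F)
  (gamma : {lrmorphism {poly F} -> L})
  (P : {poly F}) (charP : is_characteristic gamma P)
  (Lbar : closedFieldType) (iota : {rmorphism L -> Lbar})
  (algLbar : integralRange iota)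
  (Phi : drinfeld2 gamma)
  (c : {poly F}) (mu : F) (mu_neq0 : mu != 0)
  (frobPhi : is_frobenius_char_poly P Phi iota
     ('X^2 - c *: 'X + (mu *: P ^+ char_index gamma)%:P)) :
  exists i1 i2 : {poly F},
    [/\ i2 %| i1,
        exists f : {linear pts Phi (idfun : {rmorphism L -> L}) ->
                           (quotA i1 * quotA i2)%type},
          bijective f
      & ordinary P Phi iota -> i2 %| c - 2%:R].
Proof.
have [e e0 eM] := exponent_exists Phi.
have [x [y [i1 [i2 [i10 i21 sum_xy]]]]] :=
  direct_sum2_exists e0 eM (@torsion_bound _ _ _ Phi _ idfun).
have i20 := dvdpN0 i21 i10.
exists i1, i2; split=> // [|_]; first exact: direct_sum2_iso sum_xy.
(* Otherwise some prime power divides [i2] but not [c - 2]. *)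
apply: contraT => /(Ndvdp_prime_power i20)[p [k [mp irr pki2 npk]]].
have p0 := irredp_neq0 irr.
have [s [us sz_s ks]] := direct_sum2_torsion i10 i21 sum_xy pki2.
have k0 : (0 < k)%N by rewrite lt0n; apply: contraNneq npk => ->; exact: dvd1p.
pose l := PrimePoly mp irr.
(* If [p] were P, L would contain q^(2 deg p) points killed by [p], while inseparability of Phi_P
   allows only q^(2 deg p - 1). *)
have lP : prime_val l <> P.
  move=> /= eP.
  have pi2 : p %| i2 by apply: dvdp_trans pki2; rewrite -[X in X %| _]expr1 dvdp_exp2l.
  have [t [ut sz_t kt]] := direct_sum2_torsion i10 i21 sum_xy pi2.
  have gp : gamma p = 0 by apply/charP.2; rewrite eP.
  have := torsion_bound_char p0 gp ut kt.
  rewrite sz_t leq_exp2l ?finNzRing_gt1 //.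
  by case: (size p) irr.1 => [|[|m]] // _; rewrite mulnS ltnn.
have frob_id (z : pts Phi iota) : prime_val l ^+ k *: z = 0 -> frob z = z.
  by apply: (frob_torsion (s := s)) us _ ks; rewrite ?expf_neq0 ?sz_s.
set p2 := ('X^2 - _ + _) in frobPhi.
have sz_q : (size (- (c *: 'X) + (mu *: P ^+ char_index gamma)%:P)%R < size ('X^2 : {poly {poly F}})%R)%N.
  rewrite size_polyXn ltnS; apply: leq_trans (size_polyD _ _) _.
  rewrite geq_max size_polyN (leq_trans (size_scale_leq _ _)) ?size_polyX //.
  exact: leq_trans (size_polyC_leq1 _) _.
have mp2 : p2 \is monic.
  by rewrite /p2 -addrA monicE lead_coefDl // lead_coefXn.
have sz_p2 : size p2 = 3%N by rewrite /p2 -addrA size_polyDl // size_polyXn.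
have := frobenius_trace_dvd (frobPhi l lP) mp2 sz_p2 frob_id.
(* The coefficient of X is [- c], so [p ^+ k] divides [2 - c], a contradiction. *)
rewrite /p2 !coefD coefN coefZ coefX coefXn coefC /= mulr1 add0r addr0.
by rewrite -dvdpNr opprD opprK (negbTE npk).
Qed.
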